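(* For every tensor $\psi\in\Gamma$, we have $$\|\psi\|_{\max}\le\|\psi\|_\pm\le\mathrm{rank}(\psi)\cdot\|\psi\|_{\max}.$$
   Context: Fix an order $p\ge1$ and dimensions $r_1,\dots,r_p\ge1$; $[s]=\{1,\dots,s\}$ and $\mathcal R=[r_1]\times\cdots\times[r_p]$. For a tensor $\psi\in\mathbb R^{r_1\times\cdots\times r_p}$ and $x=(x_1,\dots,x_p)\in\mathcal R$, $\psi_x$ denotes the entry with indices $x$, and $\|\psi\|_{\max}=\max_{x\in\mathcal R}|\psi_x|$. Let $\mathcal S_1=\{\psi:\exists\,\theta^{(k)}\in\{-1,1\}^{r_k}\ (k\in[p])\text{ with }\psi_x=\prod_{k=1}^p\theta^{(k)}_{x_k}\ \forall x\in\mathcal R\}$, $\mathcal C_1=\mathrm{conv}(\mathcal S_1)$, and $\|\psi\|_\pm=\inf\{\lambda\ge0:\psi\in\lambda\mathcal C_1\}$, which is a norm on $\mathbb R^{r_1\times\cdots\times r_p}$. Let $\mathcal B_\infty$ be the set of tensors of the form $\psi_x=\prod_{k=1}^p\theta^{(k)}_{x_k}$ for all $x\in\mathcal R$, with arbitrary $\theta^{(k)}\in\mathbb R^{r_k}$. The rank of $\psi$ is $\mathrm{rank}(\psi)=\min\{q:\psi=\sum_{k=1}^q\psi^k,\ \psi^k\in\mathcal B_\infty\text{ for }k\in[q]\}$, and a CP decomposition of $\psi$ is an expression $\psi=\sum_{k=1}^{\mathrm{rank}(\psi)}\psi^k$ with all terms $\psi^k\in\mathcal B_\infty$. $\Gamma$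 is the set of tensors $\psi$ for which there exists at least one CP decomposition of $\psi$ with terms $\psi^k$ satisfying $\|\psi^k\|_{\max}\le\|\psi\|_{\max}$ for all $k\in[\mathrm{rank}(\psi)]$. *)

(* Defs.v *)
From HB Require Import structures.
From mathcomp Require Import all_boot all_order all_algebra.
From mathcomp Require Import boolp classical_sets reals convex.

Set Implicit Arguments.
Unset Strict Implicit.
Unset Printing Implicit Defensive.

Import Order.TTheory GRing.Theory Num.Theory.

Local Open Scope classical_set_scope.
Local Open Scope ring_scope.

Definition multi_index (p : nat) (r : 'I_p -> nat) : finType :=
  {dffun forall k : 'I_p, 'I_(r k)}.

(* The codomain is the regular module [R^o], so that tensors form an
   [lmodType R]. *)
Definition tensor (R : realType) (p : nat) (r : 'I_p -> nat) : lmodType R :=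
  {ffun multi_index r -> R^o}.

Section Tensors.
Variables (R : realType) (p : nat) (r : 'I_p -> nat).
Implicit Types psi : tensor R r.

Definition max_norm psi : R := \big[Num.max/0]_(x : multi_index r) `|psi x|.

Definition prod_tensor (theta : forall k : 'I_p, 'I_(r k) -> R) : tensor R r :=
  [ffun x : multi_index r => \prod_(k < p) theta k (x k)].

Definition sign_tensors : set (tensor R r) :=
  [set psi | exists theta : forall k : 'I_p, 'I_(r k) -> R,
     (forall k i, theta k i = -1 \/ theta k i = 1) /\ psi = prod_tensor theta].

Definition sign_hull : set (tensor R r) :=
  smallest (@convex_set R (tensor R r)) sign_tensors.

(* [inf] is real-valued, with value [0] on the empty set; since the sign
   tensors span the whole space (for [0 < p]), the set below is never empty. *)
Definition sign_norm psi : R :=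
  inf [set lam : R | 0 <= lam /\ exists2 phi, sign_hull phi & psi = lam *: phi].

Definition simple_tensors : set (tensor R r) := range prod_tensor.

Definition is_sum_of_simple psi (q : nat) (terms : 'I_q -> tensor R r) : Prop :=
  (forall k, simple_tensors (terms k)) /\ psi = \sum_(k < q) terms k.

Definition is_rank psi (q : nat) : Prop :=
  (exists terms : 'I_q -> tensor R r, is_sum_of_simple psi terms) /\
  forall (q' : nat) (terms : 'I_q' -> tensor R r),
    is_sum_of_simple psi terms -> (q <= q')%N.

(* The default [0] is never used when [0 < p], see [rankP]. *)
Definition rank psi : nat := xget 0%N [set q | is_rank psi q].

Definition is_CP_decomposition psi (terms : 'I_(rank psi) -> tensor R r) : Prop :=
  is_sum_of_simple psi terms.

Definition Gamma : set (tensor R r) :=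
  [set psi | exists terms : 'I_(rank psi) -> tensor R r,
     is_CP_decomposition terms /\
     forall k, max_norm (terms k) <= max_norm psi].

Lemma sum_of_simple_exists psi : (0 < p)%N ->
  exists (q : nat) (terms : 'I_q -> tensor R r), is_sum_of_simple psi terms.
Proof.
move=> p_gt0; pose k0 := Ordinal p_gt0.
pose th (y : multi_index r) (k : 'I_p) (i : 'I_(r k)) : R :=
  (if k == k0 then psi y else 1) * (i == y k)%:R.
pose N := #|{: multi_index r}|.
exists N, (fun j : 'I_N => prod_tensor (th (enum_val j))); split.
  by move=> j; exists (th (enum_val j)).
apply/ffunP => x; rewrite sum_ffunE.
rewrite -(big_enum_val (A := {: multi_index r}) (fun y => prod_tensor (th y) x)) /=.
rewrite (bigD1 x) //= big1 ?addr0 => [|y ne_yx].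
  rewrite ffunE (bigD1 k0) //= /th !eqxx mulr1 big1 ?mulr1 // => k /negPf->.
  by rewrite eqxx mulr1.
have [k ne_k] : exists k, x k != y k.
  apply/existsP; rewrite -negb_forall; apply: contraNN ne_yx => /forallP eqxy.
  by apply/eqP/ffunP => k; apply/esym/eqP.
by rewrite ffunE (bigD1 k) //= /th (negPf ne_k) mulr0 mul0r.
Qed.

Lemma rankP psi : (0 < p)%N -> is_rank psi (rank psi).
Proof.
move=> /(sum_of_simple_exists psi) exq.
pose P q := `[< exists terms : 'I_q -> tensor R r, is_sum_of_simple psi terms >].
have exP : exists q, P q by case: exq => q hq; exists q; apply/asboolP.
apply: (@xgetPex _ 0%N [set q | is_rank psi q]).
case: (ex_minnP exP) => q /asboolP Pq minq; exists q; split=> // q' terms h.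
by apply: minq; apply/asboolP; exists terms.
Qed.

End Tensors.

Arguments is_CP_decomposition {R p r} psi terms.
Arguments Gamma {R p r}.

(* Main.v *)
(* A convex combination of sign tensors has entries in [-1, 1], which gives the
   lower bound.  Conversely a product tensor is affine in each single entry of
   its factors, so a product of vectors with entries in [-1, 1] is a convex
   combination of sign tensors; dividing every factor of a rank-one tensor by
   its largest absolute entry puts the tensor in max_norm times the hull, and
   the scaling coefficients of the terms of a CP decomposition add up. *)
Require Import Defs.
From mathcomp Require Import all_boot all_order all_algebra.
From mathcomp Require Import boolp classical_sets reals.
From mathcomp Require Import convex interval_inference lra.
Import Order.TTheory GRing.Theory Num.Theory.
Local Open Scope ring_scope.

Section SignNorm.
Context {R : realType} {p : nat} {r : 'I_p -> nat}.
Implicit Types (psi phi : tensor R r) (theta : forall k : 'I_p, 'I_(r k) -> R).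

Lemma tensorZE (a : R) psi x : (a *: psi) x = a * psi x.
Proof. by rewrite ffunE. Qed.

Lemma ler_max_norm psi x : `|psi x| <= max_norm psi.
Proof. by rewrite /max_norm (le_bigmax _ (fun x => `|psi x|)). Qed.

Lemma max_norm_le psi (c : R) :
  0 <= c -> (forall x, `|psi x| <= c) -> max_norm psi <= c.
Proof. by move=> c0 le_c; apply: bigmax_le. Qed.

Lemma sign_hull_convex phi1 phi2 (t : R) : 0 <= t -> t <= 1 ->
  sign_hull phi1 -> sign_hull phi2 -> sign_hull (t *: phi1 + (1 - t) *: phi2).
Proof.
move=> t0 t1 h1 h2 A [cA sA].
have /set_mem := cA phi1 phi2 (Itv01 t0 t1)
  (mem_set (h1 A (conj cA sA))) (mem_set (h2 A (conj cA sA))).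
exact.
Qed.

Lemma sign_hull_sign theta :
  (forall k i, theta k i = -1 \/ theta k i = 1) -> sign_hull (prod_tensor theta).
Proof. by move=> sgn A [_ sA]; apply: sA; exists theta. Qed.

(** The tensors whose entry at [x] lies in [-1, 1] form a convex set containing the sign tensors,
    hence containing the smallest such set. *)
Lemma sign_hull_le1 phi x : sign_hull phi -> `|phi x| <= 1.
Proof.
move=> /(_ [set f : tensor R r | `|f x| <= 1]%classic); apply; split.
  move=> f g t /set_mem /= f1 /set_mem /= g1; apply/mem_set => /=.
  rewrite /conv /= !ffunE; apply: le_trans (ler_normD _ _) _.
  have t0 : 0 <= t%:num by [].
  have t1 : t%:num <= 1 by [].
  rewrite !normrM (ger0_norm t0) (@ger0_norm _ (unstable.onem _)) ?subr_ge0//.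
  rewrite /unstable.onem; nra.
move=> _ [theta [sgn ->]] /=; rewrite ffunE normr_prod big1 // => k _.
by have [->|->] := sgn k (x k); rewrite ?normrN normr1.
Qed.

(** A position is a dependent pair, since the type of [i] varies with [k]; positions in different
    factors can then be compared directly. *)
Definition update theta (t : {k : 'I_p & 'I_(r k)}) (e : R) :
    forall k : 'I_p, 'I_(r k) -> R :=
  fun k i => if Tagged (fun k => 'I_(r k)) i == t then e else theta k i.

(** This isolates the dependence on [e], which is affine: only factor [k] can contain it. *)
Lemma prod_tensor_update theta k (i : 'I_(r k)) e x :
  prod_tensor (update theta (Tagged _ i) e) x =
  (if x k == i then e else theta k (x k)) * \prod_(j < p | j != k) theta j (x j).
Proof.
rewrite ffunE (bigD1 k) //= /update eq_Tagged /=; congr (_ * _).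
by apply: eq_bigr => j /negPf nejk; rewrite -tag_eqE /tag_eq /= nejk.
Qed.

Lemma sign_hull_prod theta :
  (forall k i, `|theta k i| <= 1) -> sign_hull (prod_tensor theta).
Proof.
move=> le1.
(* Induction on a list [s] of the positions whose entries need not be signs yet; each step turns the
   head position into a sign. *)
suff hull_seq (s : seq {k : 'I_p & 'I_(r k)}) (th : forall k : 'I_p, 'I_(r k) -> R) :
    (forall k i, `|th k i| <= 1) ->
    (forall k i, Tagged (fun k => 'I_(r k)) i \notin s ->
       th k i = -1 \/ th k i = 1) ->
    sign_hull (prod_tensor th).
  by apply: (hull_seq (enum {: {k : 'I_p & 'I_(r k)}})) => // k i; rewrite mem_enum.
elim: s th => [|[k0 i0] s IHs] th th1 sgn.
  by apply: sign_hull_sign => k i; apply: sgn.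
have /andP[thm thp] : -1 <= th k0 i0 <= 1 by rewrite -ler_norml.
(* The weight for which [t * 1 + (1 - t) * (-1)] equals [th k0 i0]. *)
pose t := (1 + th k0 i0) / 2.
have -> : prod_tensor th =
    t *: prod_tensor (update th (Tagged _ i0) 1) +
    (1 - t) *: prod_tensor (update th (Tagged _ i0) (-1)).
  apply/ffunP => x; rewrite ffunE (bigD1 k0) //= [RHS]ffunE.
  rewrite !tensorZE !prod_tensor_update.
  case: eqP => [->|_]; rewrite /t; lra.
apply: sign_hull_convex; [rewrite /t; lra|rewrite /t; lra| |].
  apply: IHs => k i; rewrite /update; case: eqP => [//|/eqP ne]; rewrite ?normr1 //.
    by right.
  by move=> nis; apply: sgn; rewrite inE negb_or ne.
apply: IHs => k i; rewrite /update; case: eqP => [//|/eqP ne]; rewrite ?normrN ?normr1 //.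
  by left.
by move=> nis; apply: sgn; rewrite inE negb_or ne.
Qed.

Lemma simple_tensor_scale_hull psi : (forall k, (0 < r k)%N) ->
  simple_tensors psi ->
  exists phi, sign_hull phi /\ psi = max_norm psi *: phi.
Proof.
move=> r_gt0 [theta _ <-].
pose top k := [arg max_(i > Ordinal (r_gt0 k)) `|theta k i|]%O.
have le_top k i : `|theta k i| <= `|theta k (top k)|.
  by rewrite /top; case: arg_maxP => // j _; apply.
(* The factors are indexed independently, so their maxima are attained together, at the multi-index
   [finfun top]. *)
have -> : max_norm (prod_tensor theta) = \prod_(k < p) `|theta k (top k)|.
  apply/eqP; rewrite eq_le; apply/andP; split.
    apply: max_norm_le => [|x]; first exact: prodr_ge0.
    by rewrite ffunE normr_prod; apply: ler_prod => k _; rewrite normr_ge0 le_top.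
  have := ler_max_norm (prod_tensor theta) (finfun top).
  by rewrite ffunE normr_prod; under eq_bigr do rewrite ffunE.
exists (prod_tensor (fun k i => theta k i / `|theta k (top k)|)); split.
  apply: sign_hull_prod => k i; rewrite normrM normfV normr_id.
  (* For a zero factor the quotient is 0, because the inverse of 0 is 0. *)
  have [->|nz] := eqVneq (theta k (top k)) 0; first by rewrite normr0 invr0 mulr0.
  by rewrite ler_pdivrMr ?normr_gt0 // mul1r.
apply/ffunP => x; rewrite tensorZE !ffunE -big_split /=.
(* If the largest absolute entry is 0, the whole factor vanishes and both sides are 0. *)
apply: eq_bigr => k _; have [z|nz] := eqVneq (theta k (top k)) 0.
  apply/eqP; rewrite z normr0 mul0r -normr_le0.
  by rewrite -[X in _ <= X](normr0 R) -[X in _ <= `|X|]z.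
by rewrite mulrC divfK // normr_eq0.
Qed.

(** Dividing by [a + b] gives convex weights; if [a + b = 0], both coefficients vanish and any hull
    element serves. *)
Lemma sign_hull_cone phi1 phi2 (a b : R) : 0 <= a -> 0 <= b ->
  sign_hull phi1 -> sign_hull phi2 ->
  exists2 phi, sign_hull phi & a *: phi1 + b *: phi2 = (a + b) *: phi.
Proof.
move=> a0 b0 h1 h2; have [ab0|nz] := eqVneq (a + b) 0.
  have [-> ->] : a = 0 /\ b = 0 by split; lra.
  by exists phi1; rewrite // addr0 !scale0r addr0.
have ab_gt0 : 0 < a + b by rewrite lt_def nz addr_ge0.
exists (a / (a + b) *: phi1 + (1 - a / (a + b)) *: phi2).
  apply: sign_hull_convex => //; first by rewrite divr_ge0 // ltW.
  by rewrite ler_pdivrMr // mul1r lerDl.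
rewrite scalerDr !scalerA mulrBr mulr1 [_ * (a / _)]mulrC divfK //.
by rewrite [a + b - a]addrC addKr.
Qed.

Lemma sign_hull_sum q (a : 'I_q -> R) (phis : 'I_q -> tensor R r) :
  (forall k, 0 <= a k) -> (forall k, sign_hull (phis k)) ->
  exists2 phi, sign_hull phi &
    \sum_(k < q) a k *: phis k = (\sum_(k < q) a k) *: phi.
Proof.
elim: q a phis => [|q IHq] a phis a0 h.
  (* The empty sum has total coefficient 0, so any hull element works; the all-ones tensor is
     one. *)
  exists (prod_tensor (fun _ _ => 1)); last by rewrite !big_ord0 scale0r.
  by apply: sign_hull_sign; right.
have [phi hphi eq_phi] := IHq (fun k => a (lift ord0 k)) (fun k => phis (lift ord0 k))
  (fun k => a0 _) (fun k => h _).
rewrite !big_ord_recl eq_phi.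
by apply: sign_hull_cone => //; apply: sumr_ge0.
Qed.

Lemma sign_norm_le psi phi (c : R) :
  0 <= c -> sign_hull phi -> psi = c *: phi -> sign_norm psi <= c.
Proof.
move=> c0 hphi ->; apply: ge_inf; first by exists 0 => ? [].
by split=> //; exists phi.
Qed.

(* The hypothesis that [psi] is a multiple of a hull element excludes the junk
   value of [inf] on the empty set. *)
Lemma max_norm_le_sign_norm psi phi (c : R) :
  0 <= c -> sign_hull phi -> psi = c *: phi -> max_norm psi <= sign_norm psi.
Proof.
move=> c0 hphi eq_psi; apply: lb_le_inf; first by exists c; split=> //; exists phi.
move=> d [d0 [f hf ->]]; apply: max_norm_le => // x.
by rewrite tensorZE normrM (ger0_norm d0) ler_piMr // sign_hull_le1.
Qed.

End SignNorm.

Theorem proposition4 (R : realType) (p : nat) (r : 'I_p -> nat)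
    (p_ge1 : (1 <= p)%N) (r_ge1 : forall k : 'I_p, (1 <= r k)%N)
    (psi : tensor R r) (psi_Gamma : Gamma psi) :
  max_norm psi <= sign_norm psi /\
  sign_norm psi <= (rank psi)%:R * max_norm psi.
Proof.
have [terms [[simple eq_psi] le_terms]] := psi_Gamma.
have max_ge0 (f : tensor R r) : 0 <= max_norm f.
  by rewrite /max_norm; elim/big_ind: _ => // x y x0 y0; rewrite le_max x0.
have [phis phisP] := choice (fun k =>
  simple_tensor_scale_hull (terms k) r_ge1 (simple k)).
have [phi hphi eq_sum] := sign_hull_sum (rank psi) (fun k => max_norm (terms k)) phis
  (fun k => max_ge0 _) (fun k => (phisP k).1).
have sum_ge0 : 0 <= \sum_(k < rank psi) max_norm (terms k) by apply: sumr_ge0.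
have eq_phi : psi = (\sum_(k < rank psi) max_norm (terms k)) *: phi.
  (* Only the left-hand [psi] is expanded, since the range [rank psi] mentions [psi] too. *)
  by rewrite -eq_sum {1}eq_psi; apply: eq_bigr => k _; case: (phisP k).
split; first exact: max_norm_le_sign_norm sum_ge0 hphi eq_phi.
apply: le_trans (sign_norm_le _ _ _ sum_ge0 hphi eq_phi) _.
(* Membership in [Gamma] bounds each of the [rank psi] coefficients by [max_norm psi]. *)
apply: le_trans (ler_sum _ (fun k _ => le_terms k)) _.
by rewrite sumr_const card_ord mulr_natl.
Qed.
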